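(* Let $K$ be a field, $n\geq 2$, and $R=K[x_{ij},y_{ij}\mid 1\leq i,j\leq n]$ the polynomial ring in the $2n^2$ distinct indeterminates. Let $X=(x_{ij})_{n\times n}$, $Y=(y_{ij})_{n\times n}$ and $f_{ij}=\sum_{k=1}^n x_{ik}y_{kj}$, so that $XY=(f_{ij})_{n\times n}$. For $1\leq t\leq n$ put $k_t=1+\left(\left[\frac{n}{t}\right]-1\right)t$ (so $k_n=1$). Then the ordered set $$\mathcal{F}=\{f_{11},f_{21},\ldots,f_{n1}\}\cup\{f_{12},f_{32},\ldots,f_{k_2 2}\}\cup\{f_{13},f_{43},\ldots,f_{k_3 3}\}\cup\cdots\cup\{f_{1n}\},$$ whose $t$-th block ($1\leq t\leq n$) is $\{f_{1t},f_{(1+t)t},f_{(1+2t)t},\ldots,f_{k_t t}\}$, i.e. consists of the $f_{it}$ with $1\leq i\leq k_t$ and $i\equiv 1 \pmod t$, is a regular sequence in $R$.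
   Context: $[\cdot]$ denotes the integer part. A sequence of polynomials $p_1,\ldots,p_r$ in a polynomial ring $R$ is a regular sequence if $\langle p_1,\ldots,p_r\rangle\neq R$ and each $p_i$ is a non-zero-divisor on $R/\langle p_1,\ldots,p_{i-1}\rangle$ for $1\leq i\leq r$. The order on $\mathcal{F}$ is the listed one: blocks in order of increasing $t$, and within each block by increasing row index. *)

(* Defs.v *)
From HB Require Import structures.
From mathcomp Require Import all_boot all_order all_algebra.
From mathcomp Require Import mpoly.

Set Implicit Arguments.
Unset Strict Implicit.
Unset Printing Implicit Defensive.

Import GRing.Theory.
Local Open Scope ring_scope.

Section RegularSequence.
Variable R : comNzRingType.

Definition in_ideal (s : seq R) (g : R) : Prop :=
  exists c : 'I_(size s) -> R, g = \sum_(i < size s) c i * s`_i.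

(* [p] is a non-zero-divisor on R/<s>, expressed on representatives:
   the class of an element is zero iff the element lies in <s>. *)
Definition nonzerodivisor_mod (s : seq R) (p : R) : Prop :=
  forall g : R, in_ideal s (p * g) -> in_ideal s g.

Definition regular_sequence (s : seq R) : Prop :=
  ~ (forall g : R, in_ideal s g) /\
  (forall i, (i < size s)%N -> nonzerodivisor_mod (take i s) s`_i).

End RegularSequence.

(* The polynomial ring in n^2 + n^2 indeterminates: the first n^2 are the
   entries of X, the last n^2 those of Y, both listed in row-major order. *)
Notation polyXY K n := {mpoly K[n * n + n * n]}.

Definition genX (K : fieldType) (n : nat) : 'M[polyXY K n]_n :=
  \matrix_(i, j) 'X_(lshift (n * n) (mxvec_index i j)).

Definition genY (K : fieldType) (n : nat) : 'M[polyXY K n]_n :=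
  \matrix_(i, j) 'X_(rshift (n * n) (mxvec_index i j)).

Definition last_row (n t : nat) : nat := (1 + (n %/ t - 1) * t)%N.

(* Ordinals count from 0, so the row i and the column t : 'I_n are the
   (i.+1)-th row and the (t.+1)-th column. *)
Definition block_rows (n : nat) (t : 'I_n) : seq 'I_n :=
  [seq i : 'I_n <- enum 'I_n | (i.+1 <= last_row n t.+1)%N
                        && (i.+1 == 1 %[mod t.+1])%N].

Definition seqF (K : fieldType) (n : nat) : seq (polyXY K n) :=
  [seq (genX K n *m genY K n) i t | t <- enum 'I_n, i <- block_rows t].

(* Main.v *)
From HB Require Import structures.
Require Import Defs.
From mathcomp Require Import all_boot all_order all_algebra.
From mathcomp Require Import mpoly zify.

Import GRing.Theory.
Local Open Scope ring_scope.

(* Give [x_ik] and [y_kt] (indices from 1) weights making [x_ik y_kt], with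
   [k = i + t - 1], the unique heaviest term of [f_it] for each [f_it] in [F]:
   weights of the [y_kt] with [t | k] dominate, and [x_ii, x_i(i+1), ..., x_in]
   have decreasing weights, all above those of the [x_ik] with [k < i].  These
   leading monomials are pairwise coprime, hence form a regular sequence, and
   regularity lifts from the initial forms to the polynomials themselves. *)

(** * Ideals generated by finite lists *)

Section Ideals.
Set Implicit Arguments.
Unset Strict Implicit.

Variable R : comNzRingType.
Implicit Types (s : seq R) (p g h a : R).

(** Cofactors indexed by all of [nat] survive a change in the length of the list. *)
Lemma in_idealP s g :
  in_ideal s g <-> exists c : nat -> R, g = \sum_(i < size s) c i * s`_i.
Proof.
split=> [[c ->]|[c ->]]; last by exists (fun i => c i).
exists (fun i => if insub i is Some j then c j else 0).
by apply: eq_bigr => i _; rewrite valK.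
Qed.

Lemma in_ideal_nil g : in_ideal [::] g <-> g = 0.
Proof.
split=> [[c ->]|->]; first by rewrite big_ord0.
by exists (fun=> 0); rewrite big_ord0.
Qed.

Lemma in_ideal_rcons s p g :
  in_ideal (rcons s p) g <-> exists a, in_ideal s (g - a * p).
Proof.
rewrite in_idealP size_rcons; split=> [[c ->]|[a /in_idealP[c def_g]]].
  exists (c (size s)); apply/in_idealP; exists c.
  rewrite big_ord_recr /= nth_rcons ltnn eqxx addrK.
  by apply: eq_bigr => i _; rewrite nth_rcons ltn_ord.
exists (fun i => if (i < size s)%N then c i else a).
rewrite big_ord_recr /= nth_rcons ltnn eqxx -[LHS](subrK (a * p)) def_g.
by congr (_ + _); apply: eq_bigr => i _; rewrite nth_rcons ltn_ord.
Qed.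

Lemma in_ideal0 s : in_ideal s 0.
Proof. by exists (fun=> 0); rewrite big1 // => i _; rewrite mul0r. Qed.

Lemma in_idealD s g h : in_ideal s g -> in_ideal s h -> in_ideal s (g + h).
Proof.
move=> [c ->] [d ->]; exists (fun i => c i + d i).
by rewrite -big_split; apply: eq_bigr => i _; rewrite mulrDl.
Qed.

Lemma in_idealMl s a g : in_ideal s g -> in_ideal s (a * g).
Proof.
move=> [c ->]; exists (fun i => a * c i).
by rewrite mulr_sumr; apply: eq_bigr => i _; rewrite mulrA.
Qed.

Lemma in_idealN s g : in_ideal s g -> in_ideal s (- g).
Proof. by rewrite -mulN1r; apply: in_idealMl. Qed.

Lemma mem_in_ideal s p : p \in s -> in_ideal s p.
Proof.
move=> sp; apply/in_idealP; exists (fun i => (i == index p s)%:R).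
have lt_p : (index p s < size s)%N by rewrite index_mem.
rewrite (bigD1 (Ordinal lt_p)) //= eqxx mul1r nth_index // big1 ?addr0 // => i.
by rewrite -val_eqE /= => /negPf->; rewrite mul0r.
Qed.

Lemma in_ideal_ker (S : nzRingType) (psi : {rmorphism R -> S}) s g :
  {in s, forall p, psi p = 0} -> in_ideal s g -> psi g = 0.
Proof.
move=> psi_s [c ->]; rewrite rmorph_sum big1 // => i _.
by rewrite rmorphM /= [X in _ * X]psi_s ?mulr0 ?mem_nth.
Qed.

(** Labels in [T] let one list index both the polynomials and their initial forms; splitting [L] at
    [e] suits induction from the right. *)
Lemma regular_sequence_map (T : Type) (F : T -> R) (L : seq T) :
    ~ in_ideal (map F L) 1 ->
    (forall L1 e L2, L = L1 ++ e :: L2 ->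
       nonzerodivisor_mod (map F L1) (F e)) ->
  regular_sequence (map F L).
Proof.
move=> proper nzd; split=> [all_in|i]; first exact: proper.
rewrite size_map -map_take; case: L {proper} nzd => // e0 L nzd lt_i.
rewrite (nth_map e0) //; apply: (nzd _ _ (drop i.+1 (e0 :: L))).
by rewrite -drop_nth // cat_take_drop.
Qed.

End Ideals.

(** * Lifting regularity from initial forms *)

(* An N-grading is encoded as a coaction [phi] of the multiplicative monoid:
   [(phi p)`_d] is the component of degree [d] of [p]. *)
Section InitialForms.
Set Implicit Arguments.
Unset Strict Implicit.

Variables (R : comNzRingType) (phi : {rmorphism R -> {poly R}}).
Hypothesis phi1 : forall p, (phi p).[1] = p.
Hypothesis phi_hom : forall p d, phi (phi p)`_d = (phi p)`_d *: 'X^d.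

Variables (T : Type) (F G : T -> R) (deg : T -> nat).
Hypothesis size_F : forall e, (size (phi (F e)) <= (deg e).+1)%N.
Hypothesis lead_F : forall e, (phi (F e))`_(deg e) = G e.

Lemma phi_eq0 p : (size (phi p) <= 0)%N -> p = 0.
Proof.
by rewrite leqn0 size_poly_eq0 => /eqP p0; rewrite -(phi1 p) p0 horner0.
Qed.

Lemma phi_lead e : phi (G e) = G e *: 'X^(deg e).
Proof. by rewrite -lead_F phi_hom. Qed.

Lemma coef_phi_Mlead a e d :
  (phi (a * G e))`_d = if (d < deg e)%N then 0 else (phi a)`_(d - deg e) * G e.
Proof.
rewrite rmorphM /= phi_lead -scalerAr coefZ coefMXn.
by case: ifP => _; rewrite ?mulr0 // mulrC.
Qed.

Lemma coef_phi_top a e k : (size (phi a) <= k.+1)%N ->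
  (phi (a * F e))`_(k + deg e) = (phi a)`_k * G e.
Proof.
move=> sz_a; rewrite rmorphM /= coefM.
have lt_k : (k < (k + deg e).+1)%N by lia.
rewrite (bigD1 (Ordinal lt_k)) //= addKn lead_F big1 ?addr0 // => i.
rewrite -val_eqE /= neq_ltn => /orP[lt_ik|lt_ki].
  rewrite [X in _ * X]nth_default ?mulr0 //.
  by apply: leq_trans (size_F e) _; lia.
by rewrite nth_default ?mul0r //; apply: leq_trans sz_a _.
Qed.

Lemma size_phi_Mform a e k : (size (phi a) <= k)%N ->
  (size (phi (a * F e)%R) <= k + deg e)%N.
Proof.
move=> sz_a; rewrite rmorphM /=.
apply: leq_trans (size_polyMleq _ _) _.
by rewrite -subn1 leq_subLR add1n -addnS leq_add.
Qed.

Lemma size_phiB p q k : (size (phi p) <= k)%N -> (size (phi q) <= k)%N ->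
  (size (phi (p - q)%R) <= k)%N.
Proof.
move=> sp sq; rewrite rmorphB /=; apply: leq_trans (size_polyD _ _) _.
by rewrite size_polyN geq_max sp.
Qed.

(** Cutting each cofactor down to its component of degree [d - deg e] and then replacing [G e] by
    [F e] keeps the component of degree [d]; all others have lower degree. *)
Lemma lift_lead (L : seq T) g d : in_ideal (map G L) g ->
  exists h, [/\ in_ideal (map F L) h, (size (phi h) <= d.+1)%N
              & (phi h)`_d = (phi g)`_d].
Proof.
elim/last_ind: L g => [|L e IH] g.
  move=> /in_ideal_nil ->; exists 0; split=> //; first exact: in_ideal0.
  by rewrite rmorph0 size_poly0.
rewrite !map_rcons => /in_ideal_rcons[a /IH[h [Lh sz_h h_d]]].
set c := (phi a)`_(d - deg e).
have [lt_d|le_d] := ltnP d (deg e).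
  exists h; split=> //.
    by apply/in_ideal_rcons; exists 0; rewrite mul0r subr0.
  by rewrite h_d rmorphB coefB /= coef_phi_Mlead lt_d subr0.
have sz_c : (size (phi c) <= (d - deg e).+1)%N.
  by rewrite phi_hom (leq_trans (size_scale_leq _ _)) // size_polyXn.
exists (c * F e + h); split.
- by apply/in_ideal_rcons; exists c; rewrite addrC addrA addNr add0r.
- rewrite -[h]opprK size_phiB //; last by rewrite rmorphN size_polyN.
  by have := size_phi_Mform e sz_c; rewrite addSn subnK.
- rewrite rmorphD coefD h_d rmorphB coefB /= coef_phi_Mlead ltnNge le_d /=.
  rewrite -{1}(subnK le_d) coef_phi_top // phi_hom coefZ coefXn eqxx mulr1.
  by rewrite addrC subrK.
Qed.

(** This is the standard basis property for the grading: the component in degree [d] is the leading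
    form of [h], or zero if [h] has lower degree. *)
Definition initial_ideal_spanned (L : seq T) : Prop :=
  forall h d, in_ideal (map F L) h -> (size (phi h) <= d.+1)%N ->
    in_ideal (map G L) (phi h)`_d.

(* If [deg (a * F e)] exceeds [deg h] then the leading form of [a] times [G e]
   lies in the initial ideal, hence so does the leading form of [a]; subtracting
   a lift of it from [a] lowers the degree. *)
Lemma reduce_cofactor (L : seq T) e h a d :
    initial_ideal_spanned L -> nonzerodivisor_mod (map G L) (G e) ->
    in_ideal (map F L) (h - a * F e) -> (size (phi h) <= d)%N ->
  exists a', in_ideal (map F L) (h - a' * F e)
    /\ in_ideal (map F L) (a - a') /\ (size (phi a') <= d - deg e)%N.
Proof.
move=> inL nzd Lb sz_h; have [k] := ubnPleq (size (phi a)).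
elim: k a Lb => [|k IH] a Lb sz_a.
  by exists a; rewrite subrr; split=> //; split; [exact: in_ideal0 | lia].
have [le_k|lt_k] := leqP k.+1 (d - deg e).
  exists a; rewrite subrr; split=> //; split; first exact: in_ideal0.
  exact: leq_trans sz_a le_k.
have le_d : (d <= k + deg e)%N by lia.
have sz_b : (size (phi (h - a * F e)%R) <= (k + deg e).+1)%N.
  rewrite size_phiB //; first by apply: leq_trans sz_h _; lia.
  by rewrite -addSn size_phi_Mform.
have := inL _ _ Lb sz_b; rewrite rmorphB coefB /= nth_default; last first.
  exact: leq_trans sz_h le_d.
rewrite coef_phi_top // sub0r => /in_idealN; rewrite opprK mulrC => /nzd La_k.
have [c [Lc sz_c]] := lift_lead k La_k.
rewrite phi_hom coefZ coefXn eqxx mulr1 => c_k.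
have [||a' [Lb' [La' sz_a']]] := IH (a - c).
- rewrite mulrBl opprB addrCA; apply: in_idealD => //.
  by rewrite mulrC; apply: in_idealMl.
- apply/leq_sizeP => j; rewrite leq_eqVlt => /predU1P[<-|lt_kj].
    by rewrite rmorphB coefB /= c_k subrr.
  by move: j lt_kj; apply/leq_sizeP; apply: size_phiB.
- exists a'; split=> //; split=> //.
  by rewrite -[a](subrK c) addrAC; apply: in_idealD.
Qed.

(** Once the cofactor [a] of [F e] has degree at most [d - deg e], the component of [h] in degree
    [d] is that of [h - a * F e] plus a multiple of [G e]. *)
Lemma initial_ideal_rcons (L : seq T) e :
    initial_ideal_spanned L -> nonzerodivisor_mod (map G L) (G e) ->
  initial_ideal_spanned (rcons L e).
Proof.
move=> inL nzd h d; rewrite !map_rcons => /in_ideal_rcons[a0 La0] sz_h.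
have [a [La [_ sz_a]]] := reduce_cofactor inL nzd La0 sz_h.
have [lt_d|le_d] := ltnP d (deg e).
  (* Truncated subtraction makes [d.+1 - deg e] zero here. *)
  have a_0 : a = 0 by apply: phi_eq0; apply: leq_trans sz_a _; lia.
  apply/in_ideal_rcons; exists 0; rewrite mul0r subr0.
  by apply: inL => //; move: La; rewrite a_0 mul0r subr0.
rewrite subSn // in sz_a.
have sz_aF : (size (phi (a * F e)%R) <= d.+1)%N.
  by have := size_phi_Mform e sz_a; rewrite addSn subnK.
apply/in_ideal_rcons; exists (phi a)`_(d - deg e).
rewrite -coef_phi_top // subnK // -coefB -rmorphB.
by apply: inL => //; apply: size_phiB.
Qed.

Lemma initial_ideal_regular (L : seq T) :
    (forall L1 e L2, L = L1 ++ e :: L2 ->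
       nonzerodivisor_mod (map G L1) (G e)) ->
  initial_ideal_spanned L.
Proof.
elim/last_ind: L => [|L e IH] nzd.
  by move=> h d /in_ideal_nil -> _; rewrite rmorph0 coef0; apply: in_ideal0.
apply: initial_ideal_rcons; last by apply: (nzd _ _ [::]); rewrite cats1.
apply: IH => L1 e' L2 def_L; apply: (nzd _ _ (rcons L2 e)).
by rewrite def_L rcons_cat.
Qed.

(** Cofactor reduction is applied to [h = 0] with cofactor [g] and bound 0: the reduced cofactor
    vanishes, so [g] itself lies in the ideal. *)
Lemma regular_of_initial (L : seq T) :
    (forall L1 e L2, L = L1 ++ e :: L2 ->
       nonzerodivisor_mod (map G L1) (G e)) ->
  forall L1 e L2, L = L1 ++ e :: L2 -> nonzerodivisor_mod (map F L1) (F e).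
Proof.
move=> nzd L1 e L2 def_L g Lg.
have inL1 : initial_ideal_spanned L1.
  apply: initial_ideal_regular => L3 e' L4 def_L1.
  by apply: (nzd _ _ (L4 ++ e :: L2)); rewrite def_L def_L1 -catA.
have [||a] := @reduce_cofactor L1 e 0 g 0 inL1 (nzd _ _ _ def_L).
- by rewrite sub0r mulrC; apply: in_idealN.
- by rewrite rmorph0 size_poly0.
by move=> [_ [La /phi_eq0 a0]]; move: La; rewrite a0 subr0.
Qed.

End InitialForms.

(** * Monomial ideals and weight gradings *)

Section Monomials.
Set Implicit Arguments.
Unset Strict Implicit.

Variables (K : fieldType) (N : nat).
Implicit Types (m : 'X_{1..N}) (ms : seq 'X_{1..N}) (g : {mpoly K[N]}).

Lemma mcoeff_mulX_eq0 g m m' : ~~ (m' <= m)%MM -> (g * 'X_[m'])@_m = 0.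
Proof.
move=> ndvd; rewrite (mpolyE g) mulr_suml linear_sum big1 // => k _ /=.
rewrite -scalerAl -mpolyXD mcoeffZ mcoeffX.
by case: eqP ndvd => [<-|_]; rewrite ?mulr0 // lem_addl.
Qed.

Lemma in_monomial_idealP ms g :
  in_ideal [seq 'X_[m] | m <- ms] g <->
  {in msupp g, forall m, has (fun m' => m' <= m)%MM ms}.
Proof.
split=> [[c ->] m|g_ms].
  rewrite mcoeff_msupp; apply: contraNT => /hasPn ndvd.
  rewrite linear_sum big1 // => i _ /=.
  have := ltn_ord i; rewrite [X in (_ < X)%N]size_map => lt_i.
  by rewrite (nth_map 0%MM) // mcoeff_mulX_eq0 // ndvd // mem_nth.
rewrite [g]mpolyE big_seq; apply: big_ind => [|p q|m gm].
- exact: in_ideal0.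
- exact: in_idealD.
have /hasP[m' ms_m' dvd_m] := g_ms m gm.
rewrite -(submK dvd_m) mpolyXD scalerAl; apply: in_idealMl.
by apply: mem_in_ideal; apply: map_f.
Qed.

(** A generator that divides a product of two monomials and is coprime to one factor divides the
    other. *)
Lemma nonzerodivisor_monomial ms m :
    {in ms, forall m' i, m' i = 0%N \/ m i = 0%N} ->
  nonzerodivisor_mod [seq 'X_[m'] | m' <- ms] ('X_[m] : {mpoly K[N]}).
Proof.
move=> coprime g /in_monomial_idealP mg_ms; apply/in_monomial_idealP => k gk.
have /hasP[m' ms_m' /mnm_lepP dvd_m'] : has (fun m' => m' <= m + k)%MM ms.
  by apply: mg_ms; rewrite mcoeff_msupp mulrC mcoeffMX -mcoeff_msupp.
apply/hasP; exists m' => //; apply/mnm_lepP => i.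
have := dvd_m' i; rewrite mnmDE.
by case: (coprime _ ms_m' i) => ->.
Qed.

Variable w : 'I_N -> nat.

Definition mweight m : nat := (\sum_i w i * m i)%N.

Lemma mweightD m m' : mweight (m + m') = (mweight m + mweight m')%N.
Proof.
by rewrite -big_split; apply: eq_bigr => i _; rewrite mnmDE mulnDr.
Qed.

Lemma mweightU i : mweight U_(i) = w i.
Proof.
rewrite /mweight (bigD1 i) //= mnm1E eqxx muln1 big1 ?addn0 // => j.
by rewrite mnm1E eq_sym => /negPf->; rewrite muln0.
Qed.

(** Substituting [x_i T^(w i)] for [x_i] collects the part of weight [d] as the coefficient of
    [T^d]. *)
Definition weight_coaction : {mpoly K[N]} -> {poly {mpoly K[N]}} :=
  mmap (polyC \o @mpolyC N K) (fun i => 'X_i *: 'X^(w i)).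

HB.instance Definition _ := GRing.RMorphism.on weight_coaction.

Lemma weight_coactionX m : weight_coaction 'X_[m] = 'X_[m] *: 'X^(mweight m).
Proof.
rewrite /weight_coaction mmapX /mmap1 /mweight mpolyXE_id.
rewrite [\prod_(i < N) ('X_i *: _) ^+ _](eq_bigr
    (fun i => ('X_i ^+ m i)%:P * 'X^(w i * m i))).
  by rewrite big_split /= -rmorph_prod prodrXr mul_polyC.
by move=> i _; rewrite exprZn -exprM mul_polyC.
Qed.

Lemma weight_coactionZX c m :
  weight_coaction (c *: 'X_[m]) = (c *: 'X_[m]) *: 'X^(mweight m).
Proof.
rewrite -mul_mpolyC rmorphM /= weight_coactionX /weight_coaction mmapC /=.
by rewrite -!mul_polyC rmorphM /= mulrA.
Qed.

Lemma weight_coactionE g :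
  weight_coaction g = \sum_(m <- msupp g) (g@_m *: 'X_[m]) *: 'X^(mweight m).
Proof.
rewrite {1}[g]mpolyE raddf_sum; apply: eq_bigr => m _.
exact: weight_coactionZX.
Qed.

Lemma weight_coaction1 g : (weight_coaction g).[1] = g.
Proof.
rewrite weight_coactionE horner_sum [RHS]mpolyE; apply: eq_bigr => m _.
by rewrite hornerZ hornerXn expr1n mulr1.
Qed.

Lemma weight_coaction_hom g d :
  weight_coaction (weight_coaction g)`_d = (weight_coaction g)`_d *: 'X^d.
Proof.
have ->: (weight_coaction g)`_d
    = \sum_(m <- msupp g) (g@_m * (mweight m == d)%:R) *: 'X_[m].
  rewrite weight_coactionE coef_sum; apply: eq_bigr => m _.
  by rewrite coefZ coefXn eq_sym; case: eqP; rewrite ?mulr1 // !mulr0 scale0r.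
rewrite raddf_sum scaler_suml; apply: eq_bigr => m _ /=.
case: eqP => [<-|_]; last by rewrite mulr0 !scale0r raddf0.
by rewrite mulr1; apply: weight_coactionZX.
Qed.

Section MaxTerm.
Variables (I : finType) (m : I -> 'X_{1..N}) (i0 : I).
Hypothesis max_i0 : forall i, i != i0 -> (mweight (m i) < mweight (m i0))%N.

Lemma size_coaction_max_term :
  (size (weight_coaction (\sum_i 'X_[m i])) <= (mweight (m i0)).+1)%N.
Proof.
rewrite raddf_sum /=; apply: leq_trans (size_sum _ _ _) _.
apply/bigmax_leqP => i _.
rewrite weight_coactionX (leq_trans (size_scale_leq _ _)) // size_polyXn ltnS.
by have [->|/max_i0/ltnW] := eqVneq i i0.
Qed.

Lemma coef_coaction_max_term :
  (weight_coaction (\sum_i 'X_[m i]))`_(mweight (m i0)) = 'X_[m i0].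
Proof.
rewrite raddf_sum /= coef_sum (bigD1 i0) //= big1 => [|i /max_i0 lt_i].
  by rewrite addr0 weight_coactionX coefZ coefXn eqxx mulr1.
by rewrite weight_coactionX coefZ coefXn gtn_eqF ?mulr0.
Qed.

End MaxTerm.

End Monomials.

(** * Leading terms of the entries of XY *)

Section LeadingTerms.
Set Implicit Arguments.
Unset Strict Implicit.

Variables (K : fieldType) (n : nat).
Implicit Types (i j k t : 'I_n) (e : 'I_n * 'I_n).

Definition xvar i k : 'I_(n * n + n * n) := lshift (n * n) (mxvec_index i k).
Definition yvar k t : 'I_(n * n + n * n) := rshift (n * n) (mxvec_index k t).

(** Indices count from 0, so [n - k] lies between 1 and [n], and the weight [n.+1] in [wY] exceeds
    every entry of [wX]. *)
Definition wX : 'M[nat]_n := \matrix_(i, k) (if (i <= k)%N then n - k else 0)%N.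
Definition wY : 'M[nat]_n :=
  \matrix_(k, t) (if (t.+1 %| k.+1)%N then n.+1 else 0)%N.
Definition var_weight (v : 'I_(n * n + n * n)) : nat :=
  row_mx (mxvec wX) (mxvec wY) ord0 v.

(* A pair [(t, i)] stands for the entry [f_(i t)]. *)
Definition in_seqF e : bool :=
  (e.2.+1 <= last_row n e.1.+1)%N && (e.2.+1 == 1 %[mod e.1.+1])%N.

Definition term_exp e k : 'X_{1..n * n + n * n} :=
  (U_(xvar e.2 k) + U_(yvar k e.1))%MM.

Lemma mxvec_index_inj i j i' j' :
  mxvec_index i j = mxvec_index i' j' -> i = i' /\ j = j'.
Proof.
have [f fK _] := curry_mxvec_bij n n.
have fK' a b : f (mxvec_index a b) = (a, b) by apply: (fK (a, b)).
by move=> /(congr1 f); rewrite !fK' => -[].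
Qed.

Lemma seqF_terms e :
  (genX K n *m genY K n) e.2 e.1 = \sum_k 'X_[term_exp e k].
Proof. by rewrite mxE; apply: eq_bigr => k _; rewrite !mxE -mpolyXD. Qed.

Lemma mweight_term e k :
  mweight var_weight (term_exp e k) = (wX e.2 k + wY k e.1)%N.
Proof.
rewrite mweightD !mweightU /var_weight row_mxEl row_mxEr.
by rewrite !(mxvecE _ _ _).
Qed.

Lemma in_seqF_dvd e : in_seqF e -> (e.1.+1 %| e.2)%N.
Proof.
case/andP=> _; rewrite -[e.2.+1]addn1 -[X in _ == X %[mod _]]add0n.
by rewrite eqn_modDr mod0n.
Qed.

(** The row [e.2] is [s * e.1.+1], and ending the block at [last_row] forces [s + 1 <= n %/ e.1.+1];
    hence [e.2 + e.1.+1 <= n]. *)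
Lemma in_seqF_lead_lt e : in_seqF e -> (e.2 + e.1 < n)%N.
Proof.
move=> Fe; have /dvdnP[s def_i] := in_seqF_dvd Fe.
case/andP: Fe; rewrite /last_row => le_i _.
have := leq_divM n e.1.+1.
have := divn_gt0 n (ltn0Sn e.1); rewrite ltn_ord => q_gt0.
have le_s : (s <= n %/ e.1.+1 - 1)%N.
  by rewrite -(leq_pmul2r (ltn0Sn e.1)) -def_i.
by rewrite def_i; nia.
Qed.

(* With indices from 1, this is [k = i + t - 1], the multiple of [t] ending the
   interval of length [t] that starts at [i]. *)
Definition lead_idx e : 'I_n := insubd e.1 (e.2 + e.1)%N.

Lemma lead_idxE e : in_seqF e -> lead_idx e = (e.2 + e.1)%N :> nat.
Proof. by move=> /in_seqF_lead_lt lt_n; rewrite /lead_idx val_insubd lt_n. Qed.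

Lemma lead_term_max e k : in_seqF e -> k != lead_idx e ->
  (mweight var_weight (term_exp e k)
     < mweight var_weight (term_exp e (lead_idx e)))%N.
Proof.
move=> Fe; rewrite -val_eqE /= !mweight_term !mxE lead_idxE // => neq_k.
have dvd_i := in_seqF_dvd Fe.
have -> : (e.1.+1 %| (e.2 + e.1).+1)%N by rewrite -addnS dvdn_addr.
rewrite leq_addr.
have lt_n := in_seqF_lead_lt Fe.
have lt_k := ltn_ord k.
case: ifP => le_ik; case: ifP => dvd_k; try lia.
(* Only the case of a heavy y-variable with [e.2 <= k] is left: [e.1.+1] divides both [k.+1] and
   [e.2], so [k] lies beyond the leading index, where [n - k] is smaller. *)
have : (e.1.+1 <= k.+1 - e.2)%N by rewrite dvdn_leq ?dvdn_sub //; lia.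
lia.
Qed.

(** The leading index is the sum of row and column, so any two of the three determine the third; a
    shared x-variable or y-variable fixes two of them. *)
Lemma lead_term_coprime e e' : in_seqF e -> in_seqF e' -> e != e' -> forall v,
  term_exp e (lead_idx e) v = 0%N \/ term_exp e' (lead_idx e') v = 0%N.
Proof.
move=> Fe Fe' neq_e v; rewrite !mnmDE !mnm1E.
have lead_inj : lead_idx e = lead_idx e' -> e.1 = e'.1 \/ e.2 = e'.2 -> e = e'.
  move=> /(congr1 val) /=; rewrite !lead_idxE // => eq_k.
  rewrite [e]surjective_pairing [e']surjective_pairing /=.
  case=> eq_e; congr (_, _) => //; apply: val_inj => /=; move: eq_k;
    by rewrite eq_e; lia.
have neq_x : xvar e.2 (lead_idx e) != xvar e'.2 (lead_idx e').
  apply: contra_neq neq_e => /lshift_inj/mxvec_index_inj[eq_i eq_k].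
  by apply: lead_inj => //; right.
have neq_y : yvar (lead_idx e) e.1 != yvar (lead_idx e') e'.1.
  apply: contra_neq neq_e => /rshift_inj/mxvec_index_inj[eq_k eq_t].
  by apply: lead_inj => //; left.
have neq_xy i1 t2 k1 k2 : (xvar i1 k1 == yvar k2 t2) = false.
  by apply: eq_lrshift.
case: (eqVneq (xvar e.2 (lead_idx e)) v) => [<-|neq_xv].
  by right; rewrite [_ == xvar _ _]eq_sym (negPf neq_x) eq_sym neq_xy.
case: (eqVneq (yvar (lead_idx e) e.1) v) => [<-|neq_yv]; last by left.
by right; rewrite neq_xy eq_sym (negPf neq_y).
Qed.

End LeadingTerms.

(** * Regularity of the sequence of entries *)

Theorem theorem4p3 (K : fieldType) (n : nat) (hn : (2 <= n)%N) :
  regular_sequence (seqF K n).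
Proof.
(* Labels carry their membership proof because the leading terms are known only for such entries. *)
pose T := {e : 'I_n * 'I_n | in_seqF e}.
pose f (e : T) := (genX K n *m genY K n) (val e).2 (val e).1.
pose ld (e : T) := term_exp (val e) (lead_idx (val e)).
pose pairs := [seq (t, i) | t <- enum 'I_n, i <- block_rows t].
pose L : seq T := pmap insub pairs.
have uniqL : uniq L.
  apply: pmap_sub_uniq.
  apply: allpairs_uniq_dep => [|t _|[t i] [t' i'] _ _ [-> ->]] //.
  - exact: enum_uniq.
  - by apply: filter_uniq; apply: enum_uniq.
have -> : seqF K n = map f L.
  (* Every pair satisfies [in_seqF], so [insub] discards none. *)
  have def_L : map val L = pairs.
    rewrite (pmap_filter (insubK _)); apply/all_filterP/allP => e.
    move=> /allpairsPdep[t [i [_ + ->]]].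
    by rewrite mem_filter isSome_insub => /andP[].
  rewrite /f (map_comp (fun e => (genX K n *m genY K n) e.2 e.1)) def_L.
  by rewrite /seqF map_allpairs.
apply: regular_sequence_map.
  (* All the entries vanish at the origin, while 1 does not. *)
  move=> /(in_ideal_ker (psi := @meval _ K (fun=> 0))) one_eq0.
  suff /eqP: (1 : K) = 0 by rewrite oner_eq0.
  rewrite -[LHS](rmorph1 (@meval (n * n + n * n) K (fun=> 0))) one_eq0 //.
  move=> _ /mapP[e _ ->].
  rewrite /f seqF_terms rmorph_sum big1 // => k _ /=.
  by rewrite mpolyXD rmorphM /= mevalXU mul0r.
(* As [L] has no repetition, [e] differs from every label before it, and the leading monomials are
   coprime. *)
have nzd L1 e L2 : L = L1 ++ e :: L2 ->
    nonzerodivisor_mod [seq ('X_[ld e'] : polyXY K n) | e' <- L1] 'X_[ld e].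
  move=> def_L; rewrite (map_comp (fun m => 'X_[m]) ld).
  apply: nonzerodivisor_monomial => _ /mapP[e' L1e' ->] v.
  apply: lead_term_coprime; [exact: valP | exact: valP |].
  apply: contraTneq L1e' => /val_inj->.
  by move: uniqL; rewrite def_L cat_uniq /= negb_or => /and3P[_ /andP[]].
move=> L1 e L2 def_L.
apply: (@regular_of_initial _ (@weight_coaction K _ (@var_weight n)) _ _ _ f
  _ (fun e => mweight (@var_weight n) (ld e)) _ _ L nzd L1 e L2 def_L).
- exact: weight_coaction1.
- exact: weight_coaction_hom.
- move=> e'; rewrite /f seqF_terms; apply: size_coaction_max_term => k.
  exact: lead_term_max (valP e').
- move=> e'; rewrite /f seqF_terms; apply: coef_coaction_max_term => k.
  exact: lead_term_max (valP e').
Qed.
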